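(* Let $k \geq 2$. There exists $N = N(k)$ such that the following holds for all natural numbers $D_i, q_i, \Delta_i \geq N$, $i \in [k]$. Let $H$ be a $k$-partite $k$-uniform hypergraph with partition $V(H) = V_1 \cup \cdots \cup V_k$, and let $L : V(H) \to 2^{\mathbb{N}}$ be a list assignment for $H$ such that for each $i \in [k]$, each $v \in V_i$ and each $c \in L(v)$: (1) $\deg_H(v) \leq \Delta_i$; (2) $\deg_H(v,c) \leq D_i$; (3) $|L(v)| \geq q_i$. Suppose additionally that for some $j \in [k]$ at least one of the following holds: (C1) $\prod_{i \in [k]\setminus\{j\}} q_i \geq D_j\left(e\, q_j \sum_{i \in [k]\setminus\{j\}} \frac{q_i D_i}{D_j}\right)^{1/q_j}$; (C2) $e\left(\Delta_j\left(\sum_{i \in [k]\setminus\{j\}}\Delta_i - 1\right) + 1\right)\left(1 - \left(1 - \prod_{i \in [k]\setminus\{j\}} q_i^{-1}\right)^{\Delta_j \min_{i\in[k]} q_i / q_j}\right)^{q_j} \leq 1$; (C3) $e\left(q_j D_j\left(\sum_{i \in [k]\setminus\{j\}} q_i D_i - 1\right) + 1\right)\left(1 - \left(1 - \prod_{i \in [k]\setminus\{j\}} q_i^{-1}\right)^{D_j}\right)^{q_j} \leq 1$. Then $H$ admits a proper $L$-coloring.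
   Context: A $k$-uniform hypergraph ($k$-graph) is $k$-partite with partition $V_1,\dots,V_k$ if every edge contains exactly one vertex of each $V_i$. $[k]=\{1,\dots,k\}$. $\deg_H(v)$ is the number of edges containing $v$. For a list assignment $L: V(H)\to 2^{\mathbb{N}}$, $v \in V(H)$ and a color $c$, $E_H(v,c)$ is the set of edges $e$ containing $v$ such that $c \in L(u)$ for every $u \in e$, and $\deg_H(v,c) = |E_H(v,c)|$. A proper $L$-coloring assigns each vertex $v$ a color from $L(v)$ such that every edge contains vertices of at least two distinct colors. $e$ is Euler's number. *)

(* Defs.v *)
From mathcomp Require Import all_boot all_order all_algebra.
From mathcomp Require Import all_classical all_reals all_analysis.

Set Implicit Arguments.
Unset Strict Implicit.
Unset Printing Implicit Defensive.

Import Order.TTheory GRing.Theory Num.Theory.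

(* A hypergraph is a finite vertex type T with an edge set E : {set {set T}}. *)
Section Hypergraph.
Variables (T : finType) (k : nat).
Implicit Types (E : {set {set T}}) (V : 'I_k -> {set T}) (v : T) (c : nat).

Definition uniform_hypergraph E : Prop := forall e, e \in E -> #|e| = k.

(* Parts are allowed to be empty. *)
Definition vertex_partition V : Prop :=
  (\bigcup_(i < k) V i)%SET = [set: T]%SET /\
  (forall i j : 'I_k, i != j -> [disjoint V i & V j]).

Definition partite_hypergraph E V : Prop :=
  vertex_partition V /\
  (forall e, e \in E -> forall i : 'I_k, #|(e :&: V i)%SET| = 1).

Definition hdeg E v : nat := #|[set e in E | v \in e]%SET|.

(* Lists are arbitrary, possibly infinite, sets of natural numbers. *)
Definition color_edges E (L : T -> set nat) v c : {set {set T}} :=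
  [set e in E | (v \in e) && [forall u in e, c \in L u]]%SET.

Definition color_deg E (L : T -> set nat) v c : nat := #|color_edges E L v c|.

Definition proper_list_coloring E (L : T -> set nat) (f : T -> nat) : Prop :=
  (forall v, f v \in L v) /\
  (forall e, e \in E -> exists u w, [/\ u \in e, w \in e & f u <> f w]).

End Hypergraph.

Section Conditions.
Variables (R : realType) (k : nat) (D q Delta : 'I_k -> nat) (j : 'I_k).
Local Open Scope ring_scope.

Definition eulerE : R := expR 1.

Definition condC1 : Prop :=
  (D j)%:R *
    (eulerE * (q j)%:R *
       \sum_(i < k | i != j) ((q i)%:R * (D i)%:R / (D j)%:R)) `^ (1 / (q j)%:R)
  <= \prod_(i < k | i != j) (q i)%:R :> R.

(* The index j takes part in the minimum, so q j is a harmless default. *)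
Definition min_q : nat := \big[minn/q j]_(i < k) q i.

Definition condC2 : Prop :=
  eulerE *
    ((Delta j)%:R * ((\sum_(i < k | i != j) (Delta i)%:R) - 1) + 1) *
    (1 - (1 - \prod_(i < k | i != j) (q i)%:R^-1)
           `^ ((Delta j)%:R * min_q%:R / (q j)%:R)) ^+ q j
  <= 1 :> R.

Definition condC3 : Prop :=
  eulerE *
    ((q j)%:R * (D j)%:R *
       ((\sum_(i < k | i != j) (q i)%:R * (D i)%:R) - 1) + 1) *
    (1 - (1 - \prod_(i < k | i != j) (q i)%:R^-1) ^+ D j) ^+ q j
  <= 1 :> R.

End Conditions.

(* Main.v *)
(* Color the vertices outside V_j independently and uniformly from their lists
   (cut down to exactly q_i colors).  A vertex v of V_j cannot be colored only
   if each color c of L(v) is blocked, i.e. some edge through v is otherwise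
   entirely colored c.  The symmetric local lemma avoids this for all v at once.
   Under (C1) the bad events are indexed by v and a choice of one blocking edge
   for each color of L(v).  Under (C2) and (C3) there is one bad event per v:
   the color classes are negatively correlated, so its probability is at most
   the product over c of the probabilities that c is blocked, and Harris'
   inequality bounds each of these by 1 - (1 - p)^deg(v,c), where
   p = prod_(i <> j) 1/q_i.  For (C3) edges without a common color are first
   discarded; for (C2) the product is bounded by concavity, using that
   sum_c deg(v,c) <= Delta_j min_i q_i. *)
Require Import Defs.
From mathcomp Require Import all_boot all_order all_algebra.
From mathcomp Require Import all_classical all_reals all_analysis.
From mathcomp Require Import ring.

Set Implicit Arguments.
Unset Strict Implicit.
Unset Printing Implicit Defensive.

Import Order.TTheory GRing.Theory Num.Theory.
Local Open Scope ring_scope.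

(** * Random colorings and the local lemma *)

Section ProductExpectation.
Variables (R : realFieldType) (T C : finType).

Definition upd (f : T -> C) (u : T) (c : C) : T -> C :=
  fun x => if x == u then c else f x.

Lemma upd_upd (f : T -> C) u c d : upd (upd f u c) u d = upd f u d.
Proof. by apply/funext => x; rewrite /upd; case: eqP. Qed.

Lemma updC (f : T -> C) u v c d : u != v ->
  upd (upd f u c) v d = upd (upd f v d) u c.
Proof.
move=> uv; apply/funext => x; rewrite /upd.
by case: (eqVneq x v) => // ->; case: eqVneq uv => // ->; rewrite eqxx.
Qed.

Definition color_class (f : T -> C) (c : C) : {set T} := [set u | f u == c]%SET.

Lemma color_class_upd f u d c : color_class (upd f u d) c =
  if d == c then (u |: color_class f c)%SET else (color_class f c :\ u)%SET.
Proof.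
apply/setP => x; case: (eqVneq d c) => [->|/negPf dc]; rewrite !inE /upd;
by case: (eqVneq x u) => [_|xu]; rewrite ?dc ?eqxx.
Qed.

Variable w : T -> C -> R.
Hypothesis w_ge0 : forall u c, 0 <= w u c.
Hypothesis w_sum : forall u, \sum_c w u c = 1.

(* Expectation of [F] when the colors of the vertices of [s] are redrawn
   independently with laws [w u], the other ones being given by [f]. *)
Fixpoint expect (s : seq T) (F : (T -> C) -> R) (f : T -> C) : R :=
  if s is u :: s' then \sum_c w u c * expect s' F (upd f u c) else F f.

Lemma expect_le s F G f : (forall g, F g <= G g) -> expect s F f <= expect s G f.
Proof.
move=> FG; elim: s f => //= u s IH f.
by apply: ler_sum => c _; apply: ler_wpM2l.
Qed.

Lemma expect_const s a f : expect s (fun=> a) f = a.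
Proof.
elim: s f => //= u s IH f; under eq_bigr do rewrite IH.
by rewrite -mulr_suml w_sum mul1r.
Qed.

Lemma expect_ge0 s F f : (forall g, 0 <= F g) -> 0 <= expect s F f.
Proof. by move=> F0; rewrite -(expect_const s 0 f); apply: expect_le. Qed.

Lemma expectB s F G f :
  expect s (fun g => F g - G g) f = expect s F f - expect s G f.
Proof.
elim: s f => //= u s IH f; rewrite -sumrB; apply: eq_bigr => c _.
by rewrite IH mulrBr.
Qed.

Lemma expect_upd s F u :
  (forall f c, F (upd f u c) = F f) ->
  forall f c, expect s F (upd f u c) = expect s F f.
Proof.
move=> Fu; elim: s => //= x s IH f c; apply: eq_bigr => d _.
have [->|xu] := eqVneq x u; first by rewrite upd_upd.
by rewrite updC 1?eq_sym // IH.
Qed.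

(** Induction on [s]: one of the two factors ignores the color drawn at [u], so it comes out of the
    sum over [c], where the weights add up to 1. *)
Lemma expect_indep s F G f :
  (forall u, (forall f c, F (upd f u c) = F f) \/
             (forall f c, G (upd f u c) = G f)) ->
  expect s (fun g => F g * G g) f = expect s F f * expect s G f.
Proof.
move=> FG; elim: s f => //= u s IH f.
under eq_bigr do rewrite IH.
case: (FG u) => inv.
  have E := expect_upd s inv f; rewrite [X in _ = X * _](_ : _ = expect s F f).
    rewrite mulr_sumr; apply: eq_bigr => c _; rewrite E; ring.
  by under eq_bigr do rewrite E; rewrite -mulr_suml w_sum mul1r.
have E := expect_upd s inv f; rewrite [X in _ = _ * X](_ : _ = expect s G f).
  rewrite mulr_suml; apply: eq_bigr => c _; rewrite E; ring.
by under eq_bigr do rewrite E; rewrite -mulr_suml w_sum mul1r.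
Qed.

(** A positive sum has a positive term, at each draw in turn. The colors so chosen have positive
    weight, which later places them in the lists. *)
Lemma expect_gt0 s F f : 0 < expect s F f ->
  exists g, [/\ 0 < F g, forall u, u \in s -> 0 < w u (g u)
              & forall u, u \notin s -> g u = f u].
Proof.
elim: s f => [|u s IH] f /= F0; first by exists f.
have [c c0] : exists c, 0 < w u c * expect s F (upd f u c).
  apply/existsP; apply: contraTT F0; rewrite negb_exists => /forallP c0.
  rewrite -leNgt; apply: sumr_le0 => c _; by rewrite leNgt.
have wc : 0 < w u c.
  rewrite lt_neqAle w_ge0 andbT eq_sym; apply: contraTneq c0 => ->.
  by rewrite mul0r ltxx.
have [g [Fg gs gns]] := IH (upd f u c) ltac:(by rewrite -(pmulr_rgt0 _ wc)).
exists g; split=> // x; rewrite inE.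
  case: (boolP (x \in s)) => [/gs//|/gns gx]; rewrite orbF => /eqP xu.
  by rewrite xu in gx *; rewrite gx /upd eqxx.
by rewrite negb_or => /andP[xu /gns ->]; rewrite /upd (negPf xu).
Qed.

(** * Local lemma for events with a bounded number of neighbours *)

Section LocalLemma.
Variables (I : finType) (X : {set I}) (A : I -> (T -> C) -> bool).
Variables (dep : I -> {set T}) (d : nat) (x : R) (f0 : T -> C).
Hypothesis depP : forall i u, i \in X -> u \notin dep i ->
  forall f c, A i (upd f u c) = A i f.
Hypothesis nbr_le : forall i, i \in X ->
  (#|[set j in X | (j != i) && ~~ [disjoint dep i & dep j]]%SET| <= d)%N.
Hypothesis x_ge0 : 0 <= x.
Hypothesis x_lt1 : x < 1.
Hypothesis prob_le : forall i, i \in X ->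
  expect (enum T) (fun f => (A i f)%:R) f0 <= x * (1 - x) ^+ d.

Let avoid (s : seq I) (f : T -> C) := all (fun i => ~~ A i f) s.
Let P (B : (T -> C) -> bool) := expect (enum T) (fun f => (B f)%:R) f0.

Let P_avoid_cons i s :
  P (avoid (i :: s)) = P (avoid s) - P (fun f => A i f && avoid s f).
Proof.
rewrite /P -expectB; congr expect; apply/funext => f /=.
by case: (A i f) => /=; rewrite ?subrr ?subr0.
Qed.

Let P_le (B B' : (T -> C) -> bool) : (forall f, B f -> B' f) -> P B <= P B'.
Proof.
move=> BB; apply: expect_le => f; rewrite ler_nat.
by move: (BB f); case: (B f) => // ->.
Qed.

(* The usual conditional estimate P(A i | avoid s) <= x, in product form. *)
Lemma local_lemma_step n s i : (size s <= n)%N -> uniq s ->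
  {subset s <= X} -> i \in X -> i \notin s ->
  P (fun f => A i f && avoid s f) <= x * P (avoid s).
Proof.
have x1 : 0 <= 1 - x by rewrite subr_ge0 ltW.
have x1' : 1 - x <= 1 by rewrite gerBl.
elim: n s i => [|n IH] s i sn us sX iX is_.
  move: sn; rewrite leqn0 size_eq0 => /eqP ->.
  rewrite /P /= expect_const mulr1.
  under [X in expect _ X]eq_fun do rewrite andbT.
  apply: le_trans (prob_le iX) _; rewrite ler_piMr //.
  exact: exprn_ile1.
(* Split [s] into the events [s1] whose vertex sets meet [dep i] and the remaining ones [s2], which
   are independent of [A i]. *)
pose nbr j := ~~ [disjoint dep i & dep j].
pose s1 := seq.filter nbr s; pose s2 := seq.filter (predC nbr) s.
have s2s : {subset s2 <= s} by move=> j; rewrite mem_filter => /andP[].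
have s1s : {subset s1 <= s} by move=> j; rewrite mem_filter => /andP[].
have us12 : uniq (s1 ++ s2) by rewrite (perm_uniq (permEl (perm_filterC _ _))).
have sz12 : size (s1 ++ s2) = size s by rewrite (perm_size (permEl (perm_filterC _ _))).
have av12 f : avoid s f = avoid (s1 ++ s2) f.
  by rewrite /avoid (perm_all _ (permEl (perm_filterC nbr s))).
(* Adding the events of [t] one at a time to those avoided costs a factor [1 - x] each, by the
   induction hypothesis on [n]. It is wanted for [t = s1]. *)
have low t : (forall j, j \in t -> j \in s) -> uniq (t ++ s2) ->
    (size (t ++ s2) <= n.+1)%N ->
    (1 - x) ^+ size t * P (avoid s2) <= P (avoid (t ++ s2)).
  elim: t => [|j t IHt] ts /= ; first by rewrite expr0 mul1r.
  move=> /andP[jt ut] szt; rewrite exprS -mulrA.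
  have ts' l : l \in t -> l \in s by move=> lt; apply: ts; rewrite inE lt orbT.
  have := IHt ts' ut (ltnW szt) => /(ler_wpM2l x1) /le_trans; apply.
  rewrite P_avoid_cons mulrBl mul1r lerD2l lerN2.
  apply: IH => //; last by apply: sX; apply: ts; rewrite inE eqxx.
  by move=> l; rewrite mem_cat => /orP[/ts'|/s2s] /sX.
have {}low := low s1 s1s us12 ltac:(by rewrite sz12).
have s1d : (size s1 <= d)%N.
  apply: leq_trans (nbr_le iX); rewrite -(card_uniqP (filter_uniq nbr us)).
  apply: subset_leq_card; apply/fintype.subsetP => j; rewrite mem_filter inE => /andP[nj js].
  by rewrite sX //= -/(nbr j) nj andbT; apply: contraNneq is_ => <-.
have indep : P (fun f => A i f && avoid s2 f) =
    P (fun f => A i f) * P (avoid s2).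
  rewrite /P -expect_indep.
    by congr expect; apply/funext => f; rewrite -natrM mulnb.
  move=> u; case: (boolP (u \in dep i)) => ud; [right|left] => f c.
    congr (_%:R); congr nat_of_bool; apply: eq_in_all => j js2.
    move: (js2); rewrite mem_filter /= negbK => /andP[dis js].
    by rewrite depP ?sX // (disjointFr dis ud).
  by rewrite depP.
rewrite (_ : avoid s = avoid (s1 ++ s2)); last exact/funext.
apply: le_trans (_ : x * ((1 - x) ^+ size s1 * P (avoid s2)) <= _); last first.
  exact: ler_wpM2l.
(* Forgetting [s1] enlarges the event. Independence then gives the bound x (1 - x)^d P(avoid s2),
   and [size s1 <= d] compensates the factor lost in [low]. *)
apply: le_trans (_ : P (fun f => A i f && avoid s2 f) <= _).
  by apply: P_le => f; rewrite /avoid all_cat => /and3P[-> _ ->].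
rewrite indep mulrA ler_wpM2r //; first by apply: expect_ge0 => f; rewrite ler0n.
apply: le_trans (prob_le iX) _; rewrite ler_wpM2l //.
by rewrite ler_wiXn2l.
Qed.

(** Adding the events one by one, the conditional estimates multiply to P(no event) >= (1 - x)^|X| >
    0. *)
Lemma local_lemma : exists f : T -> C,
  (forall u, 0 < w u (f u)) /\ (forall i, i \in X -> ~~ A i f).
Proof.
have [|f [fpos wpos _]] := @expect_gt0 (enum T) (fun f => (avoid (enum X) f)%:R) f0.
  suff low s : uniq s -> {subset s <= X} -> (1 - x) ^+ size s <= P (avoid s).
    apply: lt_le_trans (low _ (enum_uniq _) _); last by move=> i; rewrite mem_enum.
    by rewrite exprn_gt0 // subr_gt0.
  elim: s => [|i s IH] /=; first by rewrite /P expr0 expect_const.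
  move=> /andP[is_ us] sX.
  have sX' : {subset s <= X} by move=> l ls; apply: sX; rewrite inE ls orbT.
  have {}IH := IH us sX'.
  have x1 : 0 <= 1 - x by rewrite subr_ge0 ltW.
  rewrite exprS; apply: le_trans (ler_wpM2l x1 IH) _.
  rewrite P_avoid_cons mulrBl mul1r lerD2l lerN2.
  by apply: local_lemma_step (leqnn _) us sX' (sX i _) is_; rewrite inE eqxx.
exists f; split=> [u|i iX]; first by apply: wpos; rewrite mem_enum.
have /allP : avoid (enum X) f by move: fpos; rewrite ltr0n lt0b.
by apply; rewrite mem_enum.
Qed.

End LocalLemma.

(** * Correlation inequalities *)

(** The case of a single vertex: the factor of [c] is [b c] if [c] is picked and [a c] otherwise. On
    the left at most one color is picked, on the right each color is picked independently. In the
    induction the gap between the two sides is p x (b x - a x) (Z - W A), where W A <= Z because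
    raising a factor from [a] to [b] cannot lower a product. *)
Lemma disjoint_choice_le (r : seq C) (p a b : C -> R) :
  uniq r -> (forall c, 0 <= p c <= 1) -> (forall c, 0 <= a c <= b c) ->
  \sum_(d <- r) p d * \prod_(c <- r) (if c == d then b c else a c) +
    (1 - \sum_(d <- r) p d) * \prod_(c <- r) a c
  <= \prod_(c <- r) ((1 - p c) * a c + p c * b c).
Proof.
move=> ur p01 ab; elim: r ur => [|x r IH] /=.
  by rewrite !big_nil subr0 mulr1 add0r.
move=> /andP[xr ur]; have {}IH := IH ur; rewrite !big_cons eqxx.
pose A := \prod_(c <- r) a c.
pose Z := \sum_(d <- r) p d * \prod_(c <- r) (if c == d then b c else a c).
pose W := \sum_(d <- r) p d.
have -> : \prod_(c <- r) (if c == x then b c else a c) = A.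
  rewrite /A big_seq [RHS]big_seq; apply: eq_bigr => c cr.
  by case: eqP => // cx; rewrite -cx cr in xr.
have -> : \sum_(d <- r) p d * \prod_(c <- x :: r) (if c == d then b c else a c)
    = a x * Z.
  rewrite /Z mulr_sumr big_seq [RHS]big_seq; apply: eq_bigr => d dr.
  rewrite big_cons; case: eqP => [xd|_]; last by ring.
  by rewrite xd dr in xr.
rewrite -/W -/A.
have WZ : W * A <= Z.
  rewrite /W /Z mulr_suml; apply: ler_sum => d _.
  apply: ler_wpM2l; first by case/andP: (p01 d).
  apply: ler_prod => c _; case/andP: (ab c) => a0 leab.
  by rewrite a0 /=; case: ifP.
have [/andP[a0 leab] /andP[p0 p1]] := (ab x, p01 x).
have k0 : 0 <= (1 - p x) * a x + p x * b x.
  by rewrite addr_ge0 ?mulr_ge0 ?subr_ge0 // (le_trans a0).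
apply: le_trans (ler_wpM2l k0 IH); rewrite -/Z -/W -/A -subr_ge0.
rewrite (_ : _ - _ = p x * (b x - a x) * (Z - W * A)); last by ring.
by rewrite !mulr_ge0 ?subr_ge0.
Qed.

(** Expectation of [G] at a random set: each vertex of [s] belongs to it independently with
    probability [b u], the other vertices as in [Z]. *)
Fixpoint bernoulli (b : T -> R) (s : seq T) (G : {set T} -> R) (Z : {set T}) : R :=
  if s is u :: s' then
    (1 - b u) * bernoulli b s' G (Z :\ u)%SET + b u * bernoulli b s' G (u |: Z)%SET
  else G Z.

Section Bernoulli.
Variable b : T -> R.
Hypothesis b01 : forall u, 0 <= b u <= 1.

Let b_ge0 u : 0 <= b u. Proof. by case/andP: (b01 u). Qed.
Let b_le1 u : 0 <= 1 - b u. Proof. by rewrite subr_ge0; case/andP: (b01 u). Qed.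

Lemma bernoulli_ge0 s G Z : (forall Y, 0 <= G Y) -> 0 <= bernoulli b s G Z.
Proof. by move=> G0; elim: s Z => //= u s IH Z; rewrite addr_ge0 ?mulr_ge0. Qed.

Lemma bernoulli_const s a Z : bernoulli b s (fun=> a) Z = a.
Proof. by elim: s Z => //= u s IH Z; rewrite !IH; ring. Qed.

Lemma bernoulliB s F G Z :
  bernoulli b s (fun Y => F Y - G Y) Z = bernoulli b s F Z - bernoulli b s G Z.
Proof. by elim: s Z => //= u s IH Z; rewrite !IH; ring. Qed.

Lemma bernoulli_mono s (G : {set T} -> R) :
  {homo G : Y Z / Y \subset Z >-> Y <= Z} ->
  {homo bernoulli b s G : Y Z / Y \subset Z >-> Y <= Z}.
Proof.
move=> G_mono; elim: s => [|u s IH] Y Z YZ /=; first exact: G_mono.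
by apply: lerD; apply: ler_wpM2l => //; apply: IH; rewrite ?finset.setSD ?finset.setUS.
Qed.

Lemma bernoulli_anti s (G : {set T} -> R) :
  {homo G : Y Z / Y \subset Z >-> Z <= Y} ->
  {homo bernoulli b s G : Y Z / Y \subset Z >-> Z <= Y}.
Proof.
move=> G_anti; elim: s => [|u s IH] Y Z YZ /=; first exact: G_anti.
by apply: lerD; apply: ler_wpM2l => //; apply: IH; rewrite ?finset.setSD ?finset.setUS.
Qed.

(** Chebyshev's inequality at each coordinate: two decreasing functions move in the same direction,
    so (1 - b) b (f0 - f1) (g0 - g1) >= 0. *)
Lemma harris2 s (F G : {set T} -> R) Z :
  {homo F : Y Z / Y \subset Z >-> Z <= Y} ->
  {homo G : Y Z / Y \subset Z >-> Z <= Y} ->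
  bernoulli b s F Z * bernoulli b s G Z <= bernoulli b s (fun Y => F Y * G Y) Z.
Proof.
move=> FA GA; elim: s Z => //= u s IH Z.
set f0 := bernoulli b s F (Z :\ u)%SET; set f1 := bernoulli b s F (u |: Z)%SET.
set g0 := bernoulli b s G (Z :\ u)%SET; set g1 := bernoulli b s G (u |: Z)%SET.
have sub : (Z :\ u)%SET \subset (u |: Z)%SET.
  by rewrite (fintype.subset_trans (subD1set _ _)) ?finset.subsetUr.
have f10 : f1 <= f0 by apply: bernoulli_anti.
have g10 : g1 <= g0 by apply: bernoulli_anti.
apply: le_trans (_ : (1 - b u) * (f0 * g0) + b u * (f1 * g1) <= _).
  rewrite -subr_ge0 (_ : _ - _ = (1 - b u) * b u * ((f0 - f1) * (g0 - g1))).
    by rewrite !mulr_ge0 ?b_le1 ?b_ge0 ?subr_ge0.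
  by ring.
by apply: lerD; [apply: ler_wpM2l (b_le1 u) _ _ (IH _) | apply: ler_wpM2l (b_ge0 u) _ _ (IH _)].
Qed.

(** Iterates the case of two functions; nonnegativity keeps the partial products decreasing. *)
Lemma harris (I : Type) (r : seq I) s (H : I -> {set T} -> R) Z :
  (forall i Y, 0 <= H i Y) ->
  (forall i, {homo H i : Y Z / Y \subset Z >-> Z <= Y}) ->
  \prod_(i <- r) bernoulli b s (H i) Z <=
  bernoulli b s (fun Y => \prod_(i <- r) H i Y) Z.
Proof.
move=> H0 HA; elim: r => [|i r IH].
  rewrite big_nil; under [X in _ <= bernoulli _ _ X _]eq_fun do rewrite big_nil.
  by rewrite bernoulli_const.
rewrite big_cons; under [X in _ <= bernoulli _ _ X _]eq_fun do rewrite big_cons.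
apply: le_trans (ler_wpM2l (bernoulli_ge0 _ _ (H0 i)) IH) _.
apply: harris2 => // Y Y' YY'; apply: ler_prod => l _.
by rewrite H0 HA.
Qed.

Lemma bernoulli_superset s (B Z : {set T}) : uniq s ->
  bernoulli b s (fun Y => (B \subset Y)%:R) Z =
  (\prod_(u <- s | u \in B) b u) * (B \subset Z :|: [set x in s])%SET%:R.
Proof.
elim: s Z => [|u s IH] Z /=.
  move=> _; rewrite big_nil mul1r.
  suff -> : (Z :|: [set x in [::]])%SET = Z by [].
  by apply/setP => x; rewrite !inE orbF.
move=> /andP[us ss]; rewrite !IH // big_cons.
have -> : ((u |: Z) :|: [set x in s] = Z :|: [set x in u :: s])%SET.
  by apply/setP => x; rewrite !inE orbCA orbA.
case: ifP => uB.
  (* If the flip at [u] fails, [u] stays out for good, since [s] has no second occurrence of it. *)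
  rewrite (_ : (B \subset (Z :\ u) :|: [set x in s])%SET = false).
    by rewrite !mulr0 add0r mulrA.
  by apply/negP => /fintype.subsetP/(_ u uB); rewrite !inE eqxx (negPf us).
rewrite (_ : (B \subset (Z :\ u) :|: [set x in s])%SET =
             (B \subset Z :|: [set x in u :: s])%SET); first by ring.
apply/fintype.subsetP/fintype.subsetP => BZ x xB; move: (BZ x xB); rewrite !inE.
  by case/orP => [/andP[_ ->]|->]; rewrite ?orbT.
by case: (eqVneq x u) => [xu|//]; rewrite -xu xB in uB.
Qed.

Lemma bernoulli_supersetT (B Z : {set T}) :
  bernoulli b (enum T) (fun Y => (B \subset Y)%:R) Z = \prod_(u in B) b u.
Proof.
rewrite bernoulli_superset ?enum_uniq // big_enum_cond /=.
rewrite (fintype.subset_trans (finset.subsetT B)) ?mulr1 //.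
by apply/fintype.subsetP => x _; rewrite !inE mem_enum orbT.
Qed.

End Bernoulli.

(* Replacing the colors by independent coin flips, one vertex at a time, can
   only increase the expectation. *)
Lemma negative_correlation s (G : C -> {set T} -> R) f :
  (forall c Y, 0 <= G c Y) ->
  (forall c, {homo G c : Y Z / Y \subset Z >-> Y <= Z}) ->
  expect s (fun g => \prod_c G c (color_class g c)) f <=
  \prod_c bernoulli (w^~ c) s (G c) (color_class f c).
Proof.
move=> G0 GM.
have w01 u c : 0 <= w u c <= 1.
  rewrite w_ge0 -(w_sum u) (bigD1 c) //= lerDl; apply: sumr_ge0 => d _.
  exact: w_ge0.
elim: s f => //= u s IH f.
(* [a c] and [b c] are the values of the factor of [c] when [u] avoids, respectively receives, the
   color [c]. As [u] receives exactly one color, the no-pick term of [disjoint_choice_le]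
   vanishes. *)
pose a c := bernoulli (w^~ c) s (G c) (color_class f c :\ u)%SET.
pose b c := bernoulli (w^~ c) s (G c) (u |: color_class f c)%SET.
apply: le_trans (_ : \sum_d w u d * \prod_c (if c == d then b c else a c) <= _).
  apply: ler_sum => d _; apply: ler_wpM2l => //.
  apply: le_trans (IH _) _; rewrite le_eqVlt; apply/orP; left; apply/eqP.
  by apply: eq_bigr => c _; rewrite color_class_upd [d == c]eq_sym; case: ifP.
have := @disjoint_choice_le (index_enum C) (w u) a b (index_enum_uniq _).
rewrite w_sum subrr mul0r addr0; apply => [//|c].
rewrite bernoulli_ge0 //=; apply: bernoulli_mono => //.
by rewrite (fintype.subset_trans (subD1set _ _)) ?finset.subsetUr.
Qed.

End ProductExpectation.

(** Take x = 1/(d+1). Then 1 - x = (1 + 1/d)^-1, and 1 + 1/d <= exp(1/d) gives (1 - x)^d >= 1/e. *)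
Lemma symmetric_local_lemma (R : realType) (T C I : finType) (w : T -> C -> R)
    (X : {set I}) (A : I -> (T -> C) -> bool) (dep : I -> {set T}) (d : nat)
    (p : R) (f0 : T -> C) :
  (forall u c, 0 <= w u c) -> (forall u, \sum_c w u c = 1) ->
  (forall i u, i \in X -> u \notin dep i ->
     forall f c, A i (upd f u c) = A i f) ->
  (forall i, i \in X ->
     (#|[set l in X | (l != i) && ~~ [disjoint dep i & dep l]]%SET| <= d)%N) ->
  (forall i, i \in X -> expect w (enum T) (fun f => (A i f)%:R) f0 <= p) ->
  (0 < d)%N -> expR 1 * d.+1%:R * p <= 1 ->
  exists f : T -> C,
    (forall u, 0 < w u (f u)) /\ (forall i, i \in X -> ~~ A i f).
Proof.
move=> w0 w1 depP nbr_le prob_le d0 ep.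
have D0 : 0 < d%:R :> R by rewrite ltr0n.
have D1 : 0 < d.+1%:R :> R by rewrite ltr0n.
have x1 : d.+1%:R^-1 < 1 :> R by rewrite invf_lt1 // ltr1n.
apply: (local_lemma w0 w1 depP nbr_le _ x1 (f0 := f0)).
  by rewrite invr_ge0 ltW.
move=> i iX; apply: le_trans (prob_le i iX) _.
have d1E : d.+1%:R = 1 + d%:R :> R by rewrite -natr1 addrC.
have -> : 1 - d.+1%:R^-1 = (1 + d%:R^-1)^-1 :> R.
  by rewrite d1E; field; rewrite !gt_eqF ?addr_gt0.
have e1 : (1 + d%:R^-1) ^+ d <= expR 1 :> R.
  rewrite -[X in expR X](@mulVf _ (d%:R : R)) ?gt_eqF // expRM_natr.
  by rewrite ler_pXn2r ?nnegrE ?addr_ge0 ?invr_ge0 ?expR_ge0 ?expR_ge1Dx.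
have e0 : 0 < expR 1 :> R := expR_gt0 _.
apply: le_trans (_ : d.+1%:R^-1 * (expR 1)^-1 <= _).
  by rewrite -invfM -[leRHS]mul1r ler_pdivlMr ?mulr_gt0 // mulrC [_ * expR 1]mulrC.
by rewrite ler_wpM2l ?invr_ge0 ?ler0n // exprVn lef_pV2 ?posrE //.
Qed.

Lemma leq_card_bigcup (I T : finType) (P : pred I) (F : I -> {set T}) :
  (#|\bigcup_(i | P i) F i|%SET <= \sum_(i | P i) #|F i|)%N.
Proof.
elim/big_rec2: _ => [|i m Y _ Ym]; first by rewrite cards0.
by apply: leq_trans (leq_card_setU _ _) _; rewrite leq_add2l.
Qed.

Lemma exists_ord_neq (k : nat) (j : 'I_k) : (1 < k)%N -> exists i : 'I_k, i != j.
Proof.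
move=> k1; have : (0 < #|[set~ j]%SET|)%N by rewrite cardsC1 card_ord -subn1 subn_gt0.
by rewrite card_gt0 => /set0Pn[i]; rewrite !inE; exists i.
Qed.

(** * Bad events in partite hypergraphs *)

Section PartiteColoring.
Variables (R : realType) (T C : finType) (k : nat) (j : 'I_k).
Variables (part : T -> 'I_k) (S : T -> {set C}) (q : 'I_k -> nat).
Hypothesis card_S : forall v, #|S v| = q (part v).
Hypothesis q_gt0 : forall i, (0 < q i)%N.

Definition common (e : {set T}) : {set C} := [set c | [forall u in e, c \in S u]]%SET.

Definition list_colorable (E : {set {set T}}) : Prop :=
  exists g : T -> C, (forall v, g v \in S v) /\
    forall e, e \in E -> exists u w, [/\ u \in e, w \in e & g u != g w].

(* [q (part u)] is [#|S u|], so [unif u] is the uniform law on [S u]. *)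
Definition unif (u : T) (c : C) : R := (c \in S u)%:R / (q (part u))%:R.

Lemma unif_ge0 u c : 0 <= unif u c.
Proof. by rewrite divr_ge0. Qed.

Lemma unif_sum u : \sum_c unif u c = 1.
Proof.
rewrite -mulr_suml -natr_sum -card_S.
have -> : (\sum_c (c \in S u) = #|S u|)%N.
  by rewrite -sum1_card [RHS]big_mkcond; apply: eq_bigr => c _; case: (c \in S u).
by rewrite divff // pnatr_eq0 card_S -lt0n.
Qed.

Lemma unif_gt0 u c : 0 < unif u c -> c \in S u.
Proof. by rewrite /unif; case: (c \in S u) => //; rewrite mul0r ltxx. Qed.

Lemma subset_class_upd (B : {set T}) (f : T -> C) u c d : u \notin B ->
  (B \subset color_class (upd f u d) c) = (B \subset color_class f c).
Proof.
move=> uB; apply/fintype.subsetP/fintype.subsetP => sub x xB; move: (sub x xB);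
  by rewrite !inE /upd; have /negPf -> : x != u by apply: contraNneq uB => <-.
Qed.

Variable E : {set {set T}}.
Hypothesis part_inj : forall e, e \in E -> {in e &, injective part}.
Hypothesis part_onto : forall e, e \in E -> (part @: e = [set: 'I_k])%SET.

Definition cedges (v : T) (c : C) : {set {set T}} :=
  [set e in E | (v \in e) && (c \in common e)]%SET.

(** For an edge through a vertex of V_j and a color common to its lists, the probability that all
    its other vertices receive that color. *)
Definition mono_prob : R := \prod_(i | i != j) (q i)%:R^-1.

(** [part] maps the vertices of [e] other than [v] bijectively onto the indices other than [j]. *)
Lemma big_edge (U : Type) (idx : U) (op : Monoid.com_law idx) (F : 'I_k -> U) e v :
  e \in E -> v \in e -> part v = j ->
  \big[op/idx]_(u in (e :\ v)%SET) F (part u) = \big[op/idx]_(i | i != j) F i.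
Proof.
move=> eE ve vj; rewrite -(@big_imset _ _ _ _ _ part (mem (e :\ v)%SET)).
  apply: eq_bigl => i; apply/imsetP/idP => [[u]|ij].
    rewrite !inE => /andP[uv ue] ->; apply: contraNneq uv => uj.
    by apply/eqP; apply: (part_inj eE) => //; rewrite uj.
  have : i \in (part @: e)%SET by rewrite part_onto // finset.in_setT.
  case/imsetP => u ue iu; exists u => //; rewrite !inE ue andbT.
  by apply: contraNneq ij => uv; rewrite iu uv vj.
move=> u u'; rewrite !inE => /andP[_ ue] /andP[_ ue']; exact: (part_inj eE).
Qed.

Lemma mono_probE e v c : e \in cedges v c -> part v = j ->
  \prod_(u in (e :\ v)%SET) unif u c = mono_prob.
Proof.
rewrite inE => /and3P[eE ve]; rewrite inE => /forall_inP ce vj.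
rewrite /mono_prob -(big_edge _ (fun i => (q i)%:R^-1) eE ve vj).
apply: eq_bigr => u; rewrite !inE => /andP[_ ue].
by rewrite /unif ce // mul1r.
Qed.

(** Keep [f] outside V_j and give each vertex of V_j a free color. Every edge has exactly one vertex
    [v] in V_j, so a monochromatic edge would block the very color chosen at [v]. *)
Lemma list_colorable_extend (f : T -> C) :
  (forall u, f u \in S u) ->
  (forall v, part v = j -> exists2 c, c \in S v &
     forall e, e \in cedges v c -> ~~ ((e :\ v)%SET \subset color_class f c)) ->
  list_colorable E.
Proof.
move=> fS free.
have /fin_all_exists[g gP] v : exists c, c \in S v /\ if part v == j
    then forall e, e \in cedges v c -> ~~ ((e :\ v)%SET \subset color_class f c)
    else c = f v.
  by case: eqP => [/free[c cS cP]|_]; [exists c | exists (f v)].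
exists g; split=> [v|e eE]; first by case: (gP v).
have : j \in (part @: e)%SET by rewrite part_onto // finset.in_setT.
case/imsetP => v ve jv.
suff /existsP[u /andP[ue guv]] : [exists u, (u \in e) && (g u != g v)].
  by exists u, v.
apply: contraT; rewrite negb_exists => /forallP same.
have {}same u : u \in e -> g u = g v.
  by move=> ue; move: (same u); rewrite ue /= negbK => /eqP.
have [_] := gP v; rewrite -jv eqxx => /(_ e) free_e.
have /free_e/negP[] : e \in cedges v (g v).
  rewrite inE eE ve /= inE; apply/forall_inP => u ue.
  by rewrite -(same u ue); case: (gP u).
apply/fintype.subsetP => u; rewrite !inE => /andP[uv ue].
have [_] := gP u; case: eqP => [uj _|_ <-]; last by rewrite same.
case/eqP: uv; apply: (part_inj eE) => //; by rewrite uj jv.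
Qed.

Lemma card_part_edge e : e \in E -> (#|[set w in e | part w == j]%SET| <= 1)%N.
Proof.
move=> eE; apply/card_le1_eqP => u u'; rewrite !inE => /andP[ue /eqP uj] /andP[u'e /eqP u'j].
by apply: (part_inj eE) => //; rewrite uj u'j.
Qed.


Lemma unif_base : exists f0 : T -> C, forall v, f0 v \in S v.
Proof.
have /fin_all_exists[f0 f0S] v : exists c, c \in S v; last by exists f0.
by apply/set0Pn; rewrite -card_gt0 card_S q_gt0.
Qed.

(* The set [finset.set0] is a dummy value for the colors outside the list. *)
Definition tuple_choices (v : T) (c : C) : {set {set T}} :=
  if c \in S v then cedges v c else [set finset.set0]%SET.

(* Bad events for (C1): [z.1] lies in V_j and [z.2] picks one edge for every
   color of the list of [z.1]. *)
Definition edge_tuples : {set T * {ffun C -> {set T}}} :=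
  [set z | (part z.1 == j) && (z.2 \in family (tuple_choices z.1))]%SET.

Definition tuple_blocks (z : T * {ffun C -> {set T}}) (f : T -> C) : bool :=
  [forall c, (z.2 c :\ z.1)%SET \subset color_class f c].

Definition tuple_dep (z : T * {ffun C -> {set T}}) : {set T} :=
  (\bigcup_c (z.2 c :\ z.1))%SET.

Lemma tuple_blocks_dep z u : u \notin tuple_dep z ->
  forall f c, tuple_blocks z (upd f u c) = tuple_blocks z f.
Proof.
move=> uz f c; apply: eq_forallb => d; rewrite subset_class_upd //.
by apply: contraNN uz => uz; apply/finset.bigcupP; exists d.
Qed.

Lemma edge_tuplesP (z : T * {ffun C -> {set T}}) : reflect (part z.1 = j /\
  forall c, z.2 c \in tuple_choices z.1 c) (z \in edge_tuples).
Proof.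
rewrite inE; apply: (iffP andP) => [[/eqP zj /familyP]|[zj fam]]; first by [].
by rewrite zj eqxx; split=> //; apply/familyP.
Qed.

(** The event is a product over colors of indicators increasing in the color class, so negative
    correlation applies. Each color of the list contributes [mono_prob], each dummy choice
    contributes 1. *)
Lemma tuple_blocks_prob z f0 : z \in edge_tuples ->
  expect unif (enum T) (fun f => (tuple_blocks z f)%:R) f0 <= mono_prob ^+ q j.
Proof.
case/edge_tuplesP => zj zfam.
pose G c (Y : {set T}) : R := ((z.2 c :\ z.1)%SET \subset Y)%:R.
have -> : (fun f => (tuple_blocks z f)%:R) =
    (fun f => \prod_c G c (color_class f c)) :> ((T -> C) -> R).
  apply/funext => f; rewrite /tuple_blocks; case: (boolP [forall c, _]) => [/forallP all_sub|].
    by rewrite big1 // => c _; rewrite /G all_sub.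
  rewrite negb_forall => /existsP[c /negPf csub].
  by rewrite (bigD1 c) //= /G csub mul0r.
apply: le_trans (negative_correlation unif_ge0 unif_sum _ _ _ _) _.
- by move=> c Y; rewrite ler0n.
- move=> c Y Z YZ; rewrite ler_nat /G.
  by case: (boolP (_ \subset Y)) => // /fintype.subset_trans/(_ YZ) ->.
rewrite (eq_bigr (fun c => \prod_(u in (z.2 c :\ z.1)%SET) unif u c)); last first.
  by move=> c _; rewrite bernoulli_supersetT.
rewrite -zj -card_S -prodr_const [leRHS]big_mkcond /=.
rewrite le_eqVlt; apply/orP; left; apply/eqP; apply: eq_bigr => c _.
have := zfam c; rewrite /tuple_choices; case: ifP => [cS|_].
  by move/mono_probE; apply.
by rewrite inE => /eqP ->; rewrite finset.set0D big_set0.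
Qed.

(** * Counting neighbouring tuples, for (C1) *)

Section TupleNeighbours.
Variable D : 'I_k -> nat.
Hypothesis deg_le : forall v c, c \in S v -> (#|cedges v c| <= D (part v))%N.

(** The only vertex of [e] in V_j must be the base of the tuple. The choice at [c] is then forced,
    leaving at most [D j] choices for each of the other [q j - 1] colors. *)
Lemma card_tuples_through e c : e \in E -> c \in common e ->
  (#|[set z in edge_tuples | (c \in S z.1) && (z.2 c == e)]%SET| <= D j ^ (q j).-1)%N.
Proof.
move=> eE ce.
have : j \in (part @: e)%SET by rewrite part_onto // finset.in_setT.
case/imsetP => w we jw.
pose F d : {set {set T}} := if d == c then [set e]%SET else tuple_choices w d.
have cw : c \in S w by move: ce; rewrite inE => /forall_inP; apply.
apply: (@leq_trans #|[set (w, h) | h in family F]%SET|).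
  apply/subset_leq_card/fintype.subsetP => -[v h]; rewrite inE /=.
  case/and3P => /edge_tuplesP /= [vj hfam] cv /eqP hc.
  have vw : v = w.
    have := hfam c; rewrite /tuple_choices cv hc inE => /and3P[_ ve _].
    by apply: (part_inj eE) => //; rewrite vj jw.
  rewrite vw in hfam *; apply/imsetP; exists h => //; apply/familyP => d.
  by rewrite /F; case: eqP => [->|_]; rewrite ?hc ?inE.
apply: leq_trans (leq_imset_card _ _) _.
rewrite card_family foldrE big_map big_enum /= (bigD1 c) //= {1}/F eqxx cards1 mul1n.
apply: (@leq_trans (\prod_(d | d != c) (if d \in S w then D j else 1))%N).
  apply: leq_prod => d /negPf dc; rewrite /F dc /tuple_choices.
  by case: ifP => [dS|_]; rewrite ?cards1 // jw deg_le.
rewrite -big_mkcondr prod_nat_const leq_eqVlt; apply/orP; left; apply/eqP.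
congr (_ ^ _)%N; rewrite jw -card_S (cardsD1 c (S w)) cw /=.
by apply: eq_card => d; rewrite !inE.
Qed.

(** A neighbour is reached by choosing a color of [z.1], a vertex [u] of the corresponding edge
    outside V_j, a color [d] of [u], an edge through [u] with common color [d], and a tuple using
    that edge at [d]. *)
Lemma card_tuple_nbr z : (1 < k)%N -> z \in edge_tuples ->
  (#|[set y in edge_tuples | (y != z) && ~~ [disjoint tuple_dep z & tuple_dep y]]%SET|
   <= (q j * ((\sum_(i | i != j) q i * D i) * D j ^ (q j).-1)).-1)%N.
Proof.
move=> k1 zX; have /edge_tuplesP[zj zfam] := zX.
pose through c e := [set y in edge_tuples | (c \in S y.1) && (y.2 c == e)]%SET.
pose U := (\bigcup_(c in S z.1) \bigcup_(u in z.2 c :\ z.1)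
  \bigcup_(d in S u) \bigcup_(e in cedges u d) through d e)%SET.
have nbrU y : y \in edge_tuples -> ~~ [disjoint tuple_dep z & tuple_dep y] -> y \in U.
  move=> yX; rewrite -setI_eq0 => /set0Pn[u]; rewrite inE.
  case/andP => /finset.bigcupP[c _ uc] /finset.bigcupP[d _ ud].
  have /edge_tuplesP[yj yfam] := yX.
  have cS : c \in S z.1.
    have := zfam c; rewrite /tuple_choices; case: ifP => // _.
    by rewrite inE => /eqP zc; rewrite zc !inE andbF in uc.
  have dS : d \in S y.1.
    have := yfam d; rewrite /tuple_choices; case: ifP => // _.
    by rewrite inE => /eqP zc; rewrite zc !inE andbF in ud.
  have := yfam d; rewrite /tuple_choices dS inE => /and3P[yE _ com].
  have uy : u \in y.2 d by move: ud; rewrite inE => /andP[].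
  apply/finset.bigcupP; exists c => //; apply/finset.bigcupP; exists u => //.
  apply/finset.bigcupP; exists d; first by move: com; rewrite inE => /forall_inP; apply.
  apply/finset.bigcupP; exists (y.2 d); first by rewrite inE yE uy com.
  by rewrite inE yX dS eqxx.
(* The count includes [z] itself, which accounts for the predecessor in the bound. An edge has a
   vertex outside V_j because k > 1. *)
have zU : z \in U.
  apply: nbrU => //; rewrite -setI_eq0 finset.setIid.
  have /set0Pn[c cS] : S z.1 != finset.set0 by rewrite -card_gt0 card_S.
  have := zfam c; rewrite /tuple_choices cS inE => /and3P[zE zc _].
  have [i ij] := exists_ord_neq j k1.
  have : i \in (part @: z.2 c)%SET by rewrite part_onto // finset.in_setT.
  case/imsetP => u uc iu; apply/set0Pn; exists u; apply/finset.bigcupP.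
  exists c => //; rewrite !inE uc andbT; apply: contraNneq ij => uz.
  by rewrite iu uz zj.
apply: (@leq_trans #|U :\ z|%SET).
  apply/subset_leq_card/fintype.subsetP => y; rewrite !inE.
  by case/and3P => yX -> dis; rewrite nbrU // inE.
suff : (#|U| <= q j * ((\sum_(i | i != j) q i * D i) * D j ^ (q j).-1))%N.
  by rewrite (cardsD1 z U) zU add1n; case: (_ * _)%N.
rewrite -{1}zj -card_S -sum_nat_const.
apply: leq_trans (leq_card_bigcup _ _) _; apply: leq_sum => c cS.
apply: leq_trans (leq_card_bigcup _ _) _.
have := zfam c; rewrite /tuple_choices cS inE => /and3P[zE zc _].
rewrite -(big_edge _ (fun i => q i * D i)%N zE zc zj) big_distrl /=.
apply: leq_sum => u _; rewrite -card_S -mulnA -sum_nat_const.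
apply: leq_trans (leq_card_bigcup _ _) _; apply: leq_sum => d dS.
apply: leq_trans (leq_card_bigcup _ _) _.
apply: (@leq_trans (\sum_(e in cedges u d) D j ^ (q j).-1)%N).
  by apply: leq_sum => e; rewrite inE => /and3P[eE _ com]; apply: card_tuples_through.
by rewrite sum_nat_const leq_mul2r deg_le ?orbT.
Qed.

Lemma list_colorable_tuples : (1 < k)%N ->
  (1 < q j * ((\sum_(i | i != j) q i * D i) * D j ^ (q j).-1))%N ->
  expR 1 * (q j * ((\sum_(i | i != j) q i * D i) * D j ^ (q j).-1))%N%:R
    * mono_prob ^+ q j <= 1 ->
  list_colorable E.
Proof.
move=> k1; set M := (q j * _)%N => M1 eM; have [f0 _] := unif_base.
have [|||||||f [fpos favoid]] := @symmetric_local_lemma R T C _ unif edge_tuples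
  tuple_blocks tuple_dep M.-1 (mono_prob ^+ q j) f0.
- exact: unif_ge0.
- exact: unif_sum.
- by move=> z u _; apply: tuple_blocks_dep.
- by move=> z; apply: card_tuple_nbr.
- by move=> z; apply: tuple_blocks_prob.
- by rewrite -ltnS prednK // ltnW.
- by rewrite prednK // ltnW.
apply: (@list_colorable_extend f) => [u|v vj]; first exact: unif_gt0.
apply: contrapT => none.
have block c : c \in S v ->
    exists2 e, e \in cedges v c & (e :\ v)%SET \subset color_class f c.
  move=> cS; apply: contrapT => free; apply: none; exists c => // e ec.
  by apply/negP => sub; apply: free; exists e.
(* If no color of [v] is free, one blocking edge per color makes up a tuple whose bad event
   occurs. *)
have /fin_all_exists[h hP] c : exists e,
    e \in tuple_choices v c /\ (e :\ v)%SET \subset color_class f c.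
  rewrite /tuple_choices; case: ifP => [/block[e]|_]; first by exists e.
  by exists finset.set0; rewrite inE eqxx finset.set0D finset.sub0set.
have /favoid/negP[] : (v, finfun h) \in edge_tuples.
  by apply/edge_tuplesP; split=> //= c; rewrite ffunE; case: (hP c).
by apply/forallP => c /=; rewrite ffunE; case: (hP c).
Qed.

End TupleNeighbours.

(** * Blocked vertices, for (C2) and (C3) *)

Definition blocked (v : T) (f : T -> C) : bool :=
  [forall c in S v, [exists e in cedges v c, (e :\ v)%SET \subset color_class f c]].

Definition link (v : T) : {set T} := (\bigcup_(e in E | v \in e) (e :\ v))%SET.

Lemma blocked_link v u : u \notin link v ->
  forall f c, blocked v (upd f u c) = blocked v f.
Proof.
move=> uv f c; apply: eq_forallb => d; congr (_ ==> _); apply: eq_existsb => e.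
case: (boolP (e \in cedges v d)) => //=; rewrite inE => /and3P[eE ve _].
rewrite subset_class_upd //; apply: contraNN uv => ue.
by apply/finset.bigcupP; exists e; rewrite ?eE.
Qed.

Lemma mono_prob_ge0 : 0 <= mono_prob.
Proof. by apply: prodr_ge0 => i _; rewrite invr_ge0 ler0n. Qed.

Lemma mono_prob_le1 : mono_prob <= 1.
Proof.
apply: prodr_ile1 => i _; rewrite invr_ge0 ler0n /= invf_le1 ?ltr0n //.
by rewrite ler1n.
Qed.

Lemma unif01 u c : 0 <= unif u c <= 1.
Proof.
rewrite unif_ge0 -(unif_sum u) (bigD1 c) //= lerDl.
by apply: sumr_ge0 => d _; apply: unif_ge0.
Qed.

Lemma blocked_prob v f0 : part v = j ->
  expect unif (enum T) (fun f => (blocked v f)%:R) f0 <=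
  \prod_(c in S v) (1 - (1 - mono_prob) ^+ #|cedges v c|).
Proof.
move=> vj.
(* [H e] indicates that [e] does not block, a decreasing function of the color class, and [G c] that
   some edge blocks [c], an increasing one. Negative correlation separates the colors, then Harris
   separates the edges of one color. *)
pose H (e Y : {set T}) : R := 1 - ((e :\ v)%SET \subset Y)%:R.
have H0 e Y : 0 <= H e Y by rewrite subr_ge0 lern1 leq_b1.
have HA e : {homo H e : Y Z / Y \subset Z >-> Z <= Y}.
  move=> Y Z YZ; rewrite lerD2l lerN2 ler_nat.
  by case: (boolP (_ \subset Y)) => // /fintype.subset_trans/(_ YZ) ->.
pose G c (Y : {set T}) : R :=
  if c \in S v then 1 - \prod_(e in cedges v c) H e Y else 1.
have -> : (fun f => (blocked v f)%:R) =
    (fun f => \prod_c G c (color_class f c)) :> ((T -> C) -> R).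
  apply/funext => f; case: (boolP (blocked v f)).
    move/forall_inP => bl; rewrite big1 // => c _; rewrite /G; case: ifP => // cS.
    have /exists_inP[e ec sub] := bl c cS.
    by rewrite (bigD1 e) //= /H sub subrr mul0r subr0.
  rewrite negb_forall => /existsP[c]; rewrite negb_imply => /andP[cS].
  rewrite negb_exists => /forallP free.
  rewrite (bigD1 c) //= /G cS big1 ?subrr ?mul0r // => e ec.
  by have := free e; rewrite ec /= => /negPf; rewrite /H => ->; rewrite subr0.
apply: le_trans (negative_correlation unif_ge0 unif_sum _ _ _ _) _.
- move=> c Y; rewrite /G; case: ifP => // _; rewrite subr_ge0.
  by apply: prodr_ile1 => e _; rewrite H0 gerBl ler0n.
- move=> c Y Z YZ; rewrite /G; case: ifP => // _; rewrite lerD2l lerN2.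
  by apply: ler_prod => e _; rewrite H0 HA.
rewrite [leRHS]big_mkcond; apply: ler_prod => c _.
have w01 u : 0 <= unif u c <= 1 by apply: unif01.
rewrite bernoulli_ge0 //=; last first.
  move=> Y; rewrite /G; case: ifP => // _; rewrite subr_ge0.
  by apply: prodr_ile1 => e _; rewrite H0 gerBl ler0n.
rewrite /G; case: ifP => [cS|_]; last by rewrite bernoulli_const.
rewrite bernoulliB bernoulli_const lerD2l lerN2 -prodr_const.
under [X in bernoulli _ _ X]eq_fun do rewrite -big_enum.
apply: le_trans (harris w01 _ _ _ H0 HA).
rewrite big_enum; apply: ler_prod => e ec.
rewrite subr_ge0 mono_prob_le1 /= bernoulliB bernoulli_const bernoulli_supersetT //.
by rewrite (mono_probE ec).
Qed.

Section DegreeNeighbours.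
Variable Delta : 'I_k -> nat.
Hypothesis deg_le : forall v, (#|[set e in E | v \in e]%SET| <= Delta (part v))%N.
Hypothesis Delta_gt0 : forall i, (0 < Delta i)%N.

(** A neighbour [w] of [v] lies on an edge [e'] meeting an edge [e] through [v] in some [u] outside
    V_j. As [e] has only one vertex in V_j, [e'] differs from [e], so [u] offers at most
    [Delta (part u) - 1] such edges, each with at most one vertex in V_j. *)
Lemma card_link_nbr v : (1 < k)%N -> part v = j ->
  (#|[set w in [set w | part w == j] | (w != v) && ~~ [disjoint link v & link w]]%SET|
   <= Delta j * (\sum_(i | i != j) Delta i).-1)%N.
Proof.
move=> k1 vj.
pose U := (\bigcup_(e in [set e in E | v \in e]) \bigcup_(u in e :\ v)
  \bigcup_(e' in [set e' in E | u \in e'] :\ e) [set w in e' | part w == j])%SET.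
apply: (@leq_trans #|U|).
  apply/subset_leq_card/fintype.subsetP => w; rewrite !inE.
  case/and3P => wj wv; rewrite -setI_eq0 => /set0Pn[u]; rewrite inE.
  case/andP => /finset.bigcupP[e /andP[eE ve] ue] /finset.bigcupP[e' /andP[e'E we'] ue'].
  apply/finset.bigcupP; exists e; first by rewrite inE eE.
  apply/finset.bigcupP; exists u => //; apply/finset.bigcupP.
  exists e'; last by rewrite inE we'.
  rewrite !inE e'E; move: ue'; rewrite inE => /andP[_ ->]; rewrite !andbT.
  apply: contraNneq wv => ee'; apply/eqP; apply: (part_inj e'E) => //.
    by rewrite ee'.
  by rewrite vj (eqP wj).
have sum_pred : (\sum_(i | i != j) (Delta i).-1 <= (\sum_(i | i != j) Delta i).-1)%N.
  have [i ij] := exists_ord_neq j k1.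
  rewrite (bigD1 i) //= [in leqRHS](bigD1 i) //=.
  rewrite -{2}(prednK (Delta_gt0 i)) addSn /= leq_add2l.
  by apply: leq_sum => l _; apply: leq_pred.
apply: leq_trans (leq_card_bigcup _ _) _.
apply: (@leq_trans (\sum_(e in [set e in E | v \in e]%SET)
    (\sum_(i | i != j) Delta i).-1)%N); last first.
  by rewrite sum_nat_const leq_mul2r -[X in Delta X]vj deg_le orbT.
apply: leq_sum => e; rewrite inE => /andP[eE ve].
apply: leq_trans (leq_card_bigcup _ _) _; apply: leq_trans sum_pred.
rewrite -(big_edge _ (fun i => (Delta i).-1) eE ve vj).
apply: leq_sum => u; rewrite !inE => /andP[_ ue].
apply: leq_trans (leq_card_bigcup _ _) _.
apply: (@leq_trans #|[set e' in E | u \in e'] :\ e|%SET).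
  rewrite -sum1_card; apply: leq_sum => e'; rewrite !inE => /and3P[_ e'E _].
  exact: card_part_edge.
have := deg_le u; rewrite (cardsD1 e) inE eE ue add1n.
by case: (Delta (part u)).
Qed.

Lemma list_colorable_degrees (P : R) : (1 < k)%N ->
  (forall v, part v = j ->
     \prod_(c in S v) (1 - (1 - mono_prob) ^+ #|cedges v c|) <= P) ->
  (0 < Delta j * (\sum_(i | i != j) Delta i).-1)%N ->
  expR 1 * (Delta j * (\sum_(i | i != j) Delta i).-1).+1%:R * P <= 1 ->
  list_colorable E.
Proof.
move=> k1 probP d0 eP; have [f0 _] := unif_base.
have [|||||f [fpos favoid]] := @symmetric_local_lemma R T C _ unif
  [set w | part w == j]%SET blocked link _ P f0 _ _ _ _ _ d0 eP.
- exact: unif_ge0.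
- exact: unif_sum.
- by move=> v u _; apply: blocked_link.
- by move=> v; rewrite inE => /eqP; apply: card_link_nbr.
- move=> v; rewrite inE => /eqP vj.
  by apply: le_trans (blocked_prob _ vj) (probP v vj).
apply: (@list_colorable_extend f) => [u|v vj]; first exact: unif_gt0.
have := favoid v; rewrite inE vj eqxx => /(_ isT).
rewrite negb_forall => /existsP[c]; rewrite negb_imply => /andP[cS].
rewrite negb_exists => /forallP free; exists c => // e ec.
by have := free e; rewrite ec.
Qed.

End DegreeNeighbours.

End PartiteColoring.

(** AM-GM twice: the product is at most (1 - mu)^n with mu the mean of the r^(x i), and mu is at
    least their geometric mean, hence at least r^y since r <= 1. *)
Lemma prod_one_sub_expr_le (R : realType) (I : finType) (A : {set I})
    (x : I -> nat) (r y : R) :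
  0 < r <= 1 -> (0 < #|A|)%N -> (\sum_(i in A) x i)%:R <= #|A|%:R * y ->
  \prod_(i in A) (1 - r ^+ x i) <= (1 - r `^ y) ^+ #|A|.
Proof.
move=> /andP[r0 r1] A0 xy.
have n0 : 0 < #|A|%:R :> R by rewrite ltr0n.
have r_ge0 := ltW r0.
have rx i : 0 <= r ^+ x i <= 1 by rewrite exprn_ge0 // exprn_ile1.
pose mu := (\sum_(i in A) r ^+ x i) / #|A|%:R.
have amu : r `^ y <= mu.
  rewrite -(@ler_pXn2r _ #|A|) ?nnegrE ?powR_ge0 //; last first.
    by rewrite divr_ge0 ?ler0n //; apply: sumr_ge0 => i _; case/andP: (rx i).
  apply: le_trans (Order.le_of_leif (leif_AGM _)); last by move=> i _; case/andP: (rx i).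
  rewrite prodrXr -!powR_mulrn ?powR_ge0 // -powRrM mulrC.
  by apply: ger_powR => //; rewrite r0.
apply: le_trans (Order.le_of_leif (leif_AGM _)) _; first by move=> i _; case/andP: (rx i); rewrite subr_ge0.
have muE : (\sum_(i in A) (1 - r ^+ x i)) / #|A|%:R = 1 - mu.
  by rewrite sumrB sumr_const mulrBl divff ?gt_eqF.
have mu1 : 0 <= 1 - mu.
  rewrite -muE divr_ge0 ?ler0n //; apply: sumr_ge0 => i _.
  by rewrite subr_ge0; case/andP: (rx i).
rewrite muE; apply: lerXn2r; rewrite ?nnegrE ?lerD2l ?lerN2 //.
by rewrite subr_ge0 (le_trans amu) // -subr_ge0.
Qed.

(** * The three conditions *)

Section Conditions.
Variables (R : realType) (T C : finType) (k : nat) (j : 'I_k).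
Variables (part : T -> 'I_k) (S : T -> {set C}) (q D Delta : 'I_k -> nat).
Variable E : {set {set T}}.
Hypothesis k_gt1 : (1 < k)%N.
Hypothesis card_S : forall v, #|S v| = q (part v).
Hypothesis q_gt1 : forall i, (1 < q i)%N.
Hypothesis D_gt1 : forall i, (1 < D i)%N.
Hypothesis Delta_gt1 : forall i, (1 < Delta i)%N.
Hypothesis part_inj : forall e, e \in E -> {in e &, injective part}.
Hypothesis part_onto : forall e, e \in E -> (part @: e = [set: 'I_k])%SET.
Hypothesis deg_le : forall v, (#|[set e in E | v \in e]%SET| <= Delta (part v))%N.
Hypothesis color_deg_le : forall v c, c \in S v ->
  (#|cedges S E v c| <= D (part v))%N.

Let q_gt0 i : (0 < q i)%N. Proof. exact: ltnW. Qed.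
Let D_gt0 i : (0 < D i)%N. Proof. exact: ltnW. Qed.
Let Delta_gt0 i : (0 < Delta i)%N. Proof. exact: ltnW. Qed.

Lemma sum_other_gt1 (F : 'I_k -> nat) :
  (forall i, (1 < F i)%N) -> (1 < \sum_(i | i != j) F i)%N.
Proof.
move=> F1; have [i ij] := exists_ord_neq j k_gt1; rewrite (bigD1 i) //=.
exact: leq_trans (F1 i) (leq_addr _ _).
Qed.

Lemma mono_prob_lt1 : mono_prob R j q < 1.
Proof.
have [i ij] := exists_ord_neq j k_gt1; rewrite /mono_prob (bigD1 i) //=.
have q1 l : 0 <= ((q l)%:R^-1 : R) <= 1.
  by rewrite invr_ge0 ler0n /= invf_le1 ?ltr0n // ler1n.
apply: le_lt_trans (_ : (q i)%:R^-1 < 1)%R; last first.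
  by rewrite invf_lt1 ?ltr0n // ltr1n.
rewrite ler_piMr ?invr_ge0 ?ler0n //.
by apply: prodr_ile1 => l _; apply: q1.
Qed.

Lemma degree_natE (F : 'I_k -> nat) : (forall i, (1 < F i)%N) ->
  (F j * (\sum_(i | i != j) F i).-1).+1%:R =
  (F j)%:R * ((\sum_(i | i != j) (F i)%:R) - 1) + 1 :> R.
Proof.
move=> F1; rewrite -natr1 natrM -subn1 natrB ?natr_sum //.
exact: ltnW (sum_other_gt1 F1).
Qed.

(** Raised to the power [q j], (C1) compares D_j^(q_j) X with the q_j-th power of the product of the
    other q_i. The division by D_j inside X leaves D_j^(q_j - 1), as in the tuple count. *)
Lemma list_colorable_C1 : condC1 R D q j -> list_colorable S E.
Proof.
rewrite /condC1 /eulerE; set X := expR 1 * _ * _ => c1.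
have sum1 : (1 < \sum_(i | i != j) q i * D i)%N.
  by apply: sum_other_gt1 => i; rewrite (leq_trans (q_gt1 i)) // leq_pmulr.
have Dj0 : 0 < (D j)%:R :> R by rewrite ltr0n.
have qj0 : (q j)%:R != 0 :> R by rewrite pnatr_eq0 -lt0n.
apply: (list_colorable_tuples (R := R) (j := j) card_S q_gt0 part_inj part_onto
  color_deg_le) => //.
  rewrite (leq_trans (q_gt1 j)) // leq_pmulr // muln_gt0 expn_gt0 D_gt0 andbT.
  exact: ltnW.
pose Q : R := \prod_(i | i != j) (q i)%:R.
have Q0 : 0 < Q by apply: prodr_gt0 => i _; rewrite ltr0n.
have X0 : 0 <= X.
  rewrite /X !mulr_ge0 ?expR_ge0 ?ler0n //; apply: sumr_ge0 => i _.
  by rewrite divr_ge0 ?mulr_ge0 ?ler0n.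
have -> : mono_prob R j q = Q^-1 by rewrite /mono_prob /Q prodfV.
rewrite exprVn ler_pdivrMr ?exprn_gt0 // mul1r.
apply: le_trans (_ : ((D j)%:R * X `^ (1 / (q j)%:R)) ^+ q j <= _); last first.
  by apply: lerXn2r; rewrite ?nnegrE ?mulr_ge0 ?powR_ge0 ?ler0n ?(ltW Q0).
rewrite exprMn -[X `^ _ ^+ _]powR_mulrn ?powR_ge0 // -powRrM.
rewrite mul1r mulVf // powRr1 // le_eqVlt; apply/orP; left; apply/eqP.
rewrite -[X in _ ^+ X * _](prednK (q_gt0 j)) exprS /X !natrM natrX natr_sum.
have -> : \sum_(i < k | i != j) ((q i)%:R * (D i)%:R / (D j)%:R) =
    (\sum_(i < k | i != j) (q i * D i)%:R) / (D j)%:R :> R.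
  by rewrite mulr_suml; apply: eq_bigr => i _; rewrite natrM.
by field; rewrite gt_eqF.
Qed.

(** Double counting: an edge through [v] is counted once per common color, and its common colors lie
    in the list of a vertex of every part, so there are at most [min_q] of them. *)
Lemma sum_card_cedges v : part v = j ->
  (\sum_(c in S v) #|cedges S E v c| <= Delta j * min_q q j)%N.
Proof.
move=> vj.
under eq_bigr do rewrite -sum1_card.
rewrite (exchange_big_dep (mem [set e in E | v \in e]%SET)) /=; last first.
  by move=> c e _; rewrite !inE => /and3P[-> ->].
apply: (@leq_trans (\sum_(e in [set e in E | v \in e]%SET) min_q q j)%N); last first.
  by rewrite sum_nat_const leq_mul2r -[X in Delta X]vj deg_le orbT.
apply: leq_sum => e; rewrite inE => /andP[eE ve]; rewrite sum1dep_card.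
have le_q i : (#|[set c | (c \in S v) && (e \in cedges S E v c)]%SET| <= q i)%N.
  have : i \in (part @: e)%SET by rewrite part_onto // finset.in_setT.
  case/imsetP => u ue ->; rewrite -card_S.
  apply/subset_leq_card/fintype.subsetP => c.
  by rewrite !inE => /and4P[_ _ _ /forall_inP]; apply.
rewrite /min_q; elim/big_ind: _ => [|a b ha hb|i _] //.
by rewrite leq_min ha hb.
Qed.

Lemma list_colorable_C2 : condC2 R q Delta j -> list_colorable S E.
Proof.
rewrite /condC2 /eulerE -/(mono_prob R j q) -degree_natE // => c2.
apply: (list_colorable_degrees (R := R) (j := j) card_S q_gt0 part_inj part_onto
  deg_le Delta_gt0 k_gt1 _ _ c2); last first.
  by rewrite muln_gt0 Delta_gt0 -subn1 subn_gt0 sum_other_gt1.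
move=> v vj; rewrite -[X in _ ^+ q X]vj -card_S.
(* The exponent in (C2) bounds the average over the [q j] colors of the number of edges able to
   block a color. *)
apply: prod_one_sub_expr_le; first by rewrite subr_gt0 mono_prob_lt1 gerBl mono_prob_ge0.
  by rewrite card_S.
rewrite card_S vj mulrC divfK ?pnatr_eq0 -?lt0n // -natrM ler_nat.
exact: sum_card_cedges.
Qed.

Lemma list_colorable_C3 : condC3 R D q j -> list_colorable S E.
Proof.
rewrite /condC3 /eulerE -/(mono_prob R j q) => c3.
(* Only edges with a common color matter, and a vertex of V_i lies on at most
   [q i * D i] of them. *)
pose E' := [set e in E | common S e != finset.set0]%SET.
have E'E e : e \in E' -> e \in E by rewrite inE => /andP[].
have cE' v c : cedges S E' v c = cedges S E v c.
  apply/setP => e; rewrite !inE; case: (e \in E) => //=.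
  case: (v \in e) => /=; last by rewrite andbF.
  rewrite andb_idl // => ce; apply/set0Pn; exists c; rewrite inE; exact: ce.
have [g [gS gE]] : list_colorable S E'.
  have qD1 i : (1 < q i * D i)%N by rewrite (leq_trans (q_gt1 i)) // leq_pmulr.
  apply: (@list_colorable_degrees R T C k j part S q card_S q_gt0 E' _ _
    (fun i => q i * D i)%N _ _ ((1 - (1 - mono_prob R j q) ^+ D j) ^+ q j)) => //.
  - by move=> e /E'E; apply: part_inj.
  - by move=> e /E'E; apply: part_onto.
  - move=> v; rewrite -card_S -sum_nat_const.
    apply: (@leq_trans #|\bigcup_(c in S v) cedges S E v c|%SET).
      apply/subset_leq_card/fintype.subsetP => e; rewrite !inE.
      case/andP => /andP[eE /set0Pn[c ce]] ve; apply/finset.bigcupP.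
      exists c; last by rewrite inE eE ve.
      by move: ce; rewrite inE => /forall_inP; apply.
    apply: leq_trans (leq_card_bigcup _ _) _; apply: leq_sum => c.
    exact: color_deg_le.
  - by move=> i; apply: ltnW.
  - move=> v vj; rewrite -vj -card_S -prodr_const; apply: ler_prod => c cS.
    rewrite cE' subr_ge0 exprn_ile1 ?subr_ge0 ?mono_prob_le1 ?gerBl ?mono_prob_ge0 //=.
    rewrite lerD2l lerN2 ler_wiXn2l ?subr_ge0 ?mono_prob_le1 ?gerBl ?mono_prob_ge0 //.
    exact: color_deg_le.
  - rewrite muln_gt0 ltnW //= -subn1 subn_gt0.
    exact: (sum_other_gt1 (F := fun i => q i * D i)%N).
  rewrite (@degree_natE (fun i => q i * D i)%N) // natrM.
  by under eq_bigr do rewrite natrM.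
(* A discarded edge has no common color, so no coloring from the lists makes it monochromatic. *)
exists g; split=> // e eE; case: (boolP (e \in E')) => [/gE//|].
rewrite inE eE /= negbK => /eqP e0.
have : j \in (part @: e)%SET by rewrite part_onto // finset.in_setT.
case/imsetP => v ve _; apply: contrapT => mono.
have : g v \in common S e; last by rewrite e0 inE.
rewrite inE; apply/forall_inP => u ue; have <- : g u = g v; last exact: gS.
by apply/eqP/negPn/negP => guv; apply: mono; exists u, v.
Qed.

End Conditions.

(** * From lists of natural numbers to finite color sets, and the theorem *)

Lemma card_ord_seq (M : nat) (s : seq nat) :
  uniq s -> (forall c, c \in s -> (c < M)%N) ->
  #|[set c : 'I_M | val c \in s]%SET| = size s.
Proof.
move=> us sM; rewrite cardE -(size_map val); apply: perm_size.
apply: uniq_perm => // [|c].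
  by rewrite map_inj_uniq ?enum_uniq //; apply: val_inj.
apply/mapP/idP => [[d]|cs]; first by rewrite mem_enum inE => ds ->.
by exists (Ordinal (sM c cs)) => //; rewrite mem_enum inE.
Qed.

Lemma card_le_seq (n : nat) (A : set nat) : card_le (`I_n)%classic A ->
  exists s : seq nat, [/\ uniq s, size s = n & forall c, c \in s -> c \in A].
Proof.
move=> /pcard_leP[f]; exists [seq f i | i <- iota 0 n].
split; last 1 first.
- move=> c /mapP[i]; rewrite mem_iota add0n => /= iltn ->.
  by apply/mem_set; apply: funS.
- rewrite map_inj_in_uniq ?iota_uniq // => a b; rewrite !mem_iota !add0n /= => an bn.
  by apply: (@inj _ _ _ f); apply/mem_set.
- by rewrite size_map size_iota.
Qed.

Theorem theorem1p4 (R : realType) (k : nat) (hk : (2 <= k)%N) :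
  exists N : nat,
  forall (D q Delta : 'I_k -> nat),
  (forall i : 'I_k, [/\ (N <= D i)%N, (N <= q i)%N & (N <= Delta i)%N]) ->
  forall (T : finType) (E : {set {set T}}) (V : 'I_k -> {set T})
         (L : T -> set nat),
  uniform_hypergraph k E ->
  partite_hypergraph E V ->
  (forall (i : 'I_k) (v : T), v \in V i ->
     [/\ (hdeg E v <= Delta i)%N,
         (forall c : nat, c \in L v -> (color_deg E L v c <= D i)%N) &
         card_le (`I_(q i))%classic (L v)]) ->
  (exists j : 'I_k,
     [\/ condC1 R D q j, condC2 R q Delta j | condC3 R D q j]) ->
  exists f : T -> nat, proper_list_coloring E L f.
Proof.
(* N = 2 suffices: parameters above 1 make [mono_prob] less than 1 and the neighbour counts
   positive. *)
exists 2 => D q Delta N_le T E V L _ [[Vcover Vdisj] EV] HV cond.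
have D1 i : (1 < D i)%N by case: (N_le i).
have q1 i : (1 < q i)%N by case: (N_le i).
have Delta1 i : (1 < Delta i)%N by case: (N_le i).
have /fin_all_exists[part partP] v : exists i, v \in V i.
  have : v \in (\bigcup_(i < k) V i)%SET by rewrite Vcover inE.
  by case/finset.bigcupP => i _ vi; exists i.
have partE v i : v \in V i -> part v = i.
  move=> vi; apply/eqP; apply: contraT => /Vdisj /disjointFr /(_ (partP v)).
  by rewrite vi.
have part_inj e : e \in E -> {in e &, injective part}.
  move=> eE u u' ue u'e uu'.
  have /eqP/cards1P[x ex] := EV e eE (part u).
  have : u \in [set x]%SET by rewrite -ex inE ue partP.
  have : u' \in [set x]%SET by rewrite -ex inE u'e uu' partP.
  by rewrite !inE => /eqP -> /eqP.
have part_onto e : e \in E -> (part @: e = [set: 'I_k])%SET.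
  move=> eE; apply/eqP; rewrite finset.eqEsubset finset.subsetT /=.
  apply/fintype.subsetP => i _; have /eqP/cards1P[x ex] := EV e eE i.
  have : x \in (e :&: V i)%SET by rewrite ex inE.
  by rewrite inE => /andP[xe xi]; apply/imsetP; exists x => //; rewrite (partE x i).
have /fin_all_exists[s sP] v : exists s : seq nat,
    [/\ uniq s, size s = q (part v) & forall c, c \in s -> c \in L v].
  by have [_ _] := HV _ v (partP v); apply: card_le_seq.
(* Finitely many colors remain once each list is cut down to [q (part v)] colors, and all of them
   fit in ['I_M.+1]. *)
pose M := (\max_v \max_(c <- s v) c)%N.
pose S v := [set c : 'I_M.+1 | val c \in s v]%SET.
have SL v c : c \in S v -> val c \in L v.
  by have [_ _ sL] := sP v; rewrite finset.in_set; apply: sL.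
have card_S v : #|S v| = q (part v).
  have [us <- _] := sP v; apply: card_ord_seq => // c cs.
  rewrite ltnS; apply: leq_trans (leq_bigmax v).
  by rewrite (big_rem c) //= leq_maxl.
have deg_le v : (#|[set e in E | v \in e]%SET| <= Delta (part v))%N.
  by have [] := HV _ v (partP v).
have color_deg_le v c : c \in S v -> (#|cedges S E v c| <= D (part v))%N.
  move=> cS; have [_ deg _] := HV _ v (partP v).
  (* Shrinking the lists can only lower the color degrees. *)
  apply: leq_trans (deg _ (SL v c cS)); apply/subset_leq_card/fintype.subsetP => e.
  rewrite !inE => /and3P[-> -> /forall_inP com] /=.
  by apply/forall_inP => u ue; apply: SL; apply: com.
have [g [gS gE]] : list_colorable S E.
  case: cond => j [c1|c2|c3].
  - exact: (list_colorable_C1 hk card_S q1 D1 part_inj part_onto color_deg_le c1).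
  - exact: (list_colorable_C2 hk card_S q1 Delta1 part_inj part_onto deg_le c2).
  - exact: (list_colorable_C3 hk card_S q1 D1 part_inj part_onto color_deg_le c3).
exists (fun v => val (g v)); split=> [v|e /gE[u [u' [ue u'e guu']]]].
  exact: SL.
by exists u, u'; split=> // /val_inj /eqP; apply/negP.
Qed.
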